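(* Consider the single stage pricing game with multiplicative loyalty described in the context, with parameters $c_A\ge c_B\ge 0$, $l_\alpha,l_\beta>0$, $\theta\in(0,1)$, and $F$ the distribution function of the uniform distribution on $[0,1]$. Suppose (Region I) $$l_\beta\le c_A-c_B\le 2l_\alpha .$$ Then the game has a unique pure Nash equilibrium, and its prices are $$p_A^\alpha=\tfrac13(2c_A+c_B+2l_\alpha),\quad p_A^\beta=c_A,\quad p_B^\beta=c_A,\quad p_B^\alpha=\tfrac13(2c_B+c_A+l_\alpha) .$$
   Context: Two firms $A$ and $B$ sell the same product, with unit product costs $c_A$ and $c_B$, where $c_A\ge c_B\ge 0$. Customers are partitioned into a set $\alpha$ (ex ante loyal to $A$; a fraction $\theta$ of the market) and a set $\beta$ (ex ante loyal to $B$; a fraction $1-\theta$). Both firms can tell the two sets apart. Each customer buys exactly one unit, from $A$ or from $B$. Firms move simultaneously: $A$ chooses $(p_A^\alpha,p_A^\beta)$ with $p_A^\alpha,p_A^\beta\ge c_A$, and $B$ chooses $(p_B^\beta,p_B^\alpha)$ with $p_B^\beta,p_B^\alpha\ge c_B$; the superscript is the set of customers to which the price is offered. Multiplicative loyalty: a customer in $\alpha$ has loyalty level $l_\alpha\xi$ and buys from $A$ iff $l_\alpha\xi\ge p_A^\alpha-p_B^\alpha$; a customer in $\beta$ has loyalty level $l_\beta\xi$ and buys from $B$ iff $l_\beta\xi\ge p_B^\beta-p_A^\beta$; here $\xi$ is random with distribution function $F$. Put $\xi^\alpha=(p_A^\alpha-p_B^\alpha)/l_\alpha$ and $\xi^\beta=(p_B^\beta-p_A^\beta)/l_\beta$.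 For the uniform distribution, $F(x)=0$ for $x\le 0$, $F(x)=x$ for $0\le x\le1$, $F(x)=1$ for $x\ge1$. Profits: firm $A$ gets $(p_A^\alpha-c_A)\,\theta\,(1-F(\xi^\alpha))+(p_A^\beta-c_A)(1-\theta)F(\xi^\beta)$; firm $B$ gets $(p_B^\beta-c_B)(1-\theta)(1-F(\xi^\beta))+(p_B^\alpha-c_B)\,\theta\,F(\xi^\alpha)$. A pure Nash equilibrium is a price profile $(p_A^\alpha,p_A^\beta,p_B^\beta,p_B^\alpha)$ from which neither firm can strictly increase its profit by unilaterally changing its own (feasible) prices. *)

(* Defs.v *)
From mathcomp Require Import all_boot all_order all_algebra.
From mathcomp Require Import reals.

Set Implicit Arguments.
Unset Strict Implicit.
Unset Printing Implicit Defensive.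

Import Order.TTheory GRing.Theory Num.Theory.

Local Open Scope ring_scope.

Record game (R : realType) := Game {
  costA : R;
  costB : R;
  loyal_a : R;        (* l_alpha *)
  loyal_b : R;        (* l_beta *)
  share_a : R;        (* theta, the fraction of customers in alpha *)
  loyalty_cdf : R -> R  (* F, the distribution function of xi *)
}.

(* [pAa] is p_A^alpha, the price offered by A to the customers in alpha, etc. *)
Record prices (R : realType) := Prices {
  pAa : R;
  pAb : R;
  pBb : R;
  pBa : R
}.

Section Game.
Variables (R : realType) (G : game R).
Implicit Type p : prices R.

Definition feasibleA p : Prop := costA G <= pAa p /\ costA G <= pAb p.

Definition feasibleB p : Prop := costB G <= pBb p /\ costB G <= pBa p.

(* Loyalty thresholds: a customer of alpha (resp. beta) stays with A (resp. B)
   iff xi >= xi_a p (resp. xi >= xi_b p). *)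
Definition xi_a p : R := (pAa p - pBa p) / loyal_a G.

Definition xi_b p : R := (pBb p - pAb p) / loyal_b G.

Definition profitA p : R :=
  (pAa p - costA G) * share_a G * (1 - loyalty_cdf G (xi_a p))
  + (pAb p - costA G) * (1 - share_a G) * loyalty_cdf G (xi_b p).

Definition profitB p : R :=
  (pBb p - costB G) * (1 - share_a G) * (1 - loyalty_cdf G (xi_b p))
  + (pBa p - costB G) * share_a G * loyalty_cdf G (xi_a p).

Definition deviateA p (x y : R) : prices R := Prices x y (pBb p) (pBa p).

Definition deviateB p (x y : R) : prices R := Prices (pAa p) (pAb p) x y.

(* A deviating firm may change both of its prices at once. *)
Definition pure_nash p : Prop :=
  [/\ feasibleA p, feasibleB p,
      (forall x y : R, feasibleA (deviateA p x y) ->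
         profitA (deviateA p x y) <= profitA p)
    & (forall x y : R, feasibleB (deviateB p x y) ->
         profitB (deviateB p x y) <= profitB p)].

End Game.

Definition uniform01_cdf (R : realType) (x : R) : R :=
  if x <= 0 then 0 else if x <= 1 then x else 1.

(* Main.v *)
Require Import Defs.
From mathcomp Require Import all_boot all_order all_algebra.
From mathcomp Require Import reals.
From mathcomp Require Import ring lra.

Import Order.TTheory GRing.Theory Num.Theory.

Local Open Scope ring_scope.

(** Profits are separable over the two customer sets, so a profile is an
    equilibrium iff each set carries an equilibrium of the one-price game
    between the incumbent (the firm its customers are loyal to) and the entrant.
    Set alpha has an incumbent with the higher cost: the entrant always makes a
    positive profit, so the first-order conditions of two concave quadratics
    hold and determine the prices. In set beta the incumbent's cost advantage
    is at least [lb], so its profit strictly decreases once it charges more than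
    the entrant, and Bertrand competition drives both prices to the entrant's
    cost. *)

Definition incumbent_profit {R : realType} (l c p r : R) : R :=
  (p - c) * (1 - uniform01_cdf ((p - r) / l)).

(** In both profits [p] is the incumbent's price and [r] the entrant's, while [c] is the cost of the
    firm whose profit it is. *)
Definition entrant_profit {R : realType} (l c p r : R) : R :=
  (r - c) * uniform01_cdf ((p - r) / l).

Definition segment_nash {R : realType} (l cI cE p r : R) : Prop :=
  [/\ cI <= p, cE <= r,
      (forall p', cI <= p' ->
         incumbent_profit l cI p' r <= incumbent_profit l cI p r)
    & (forall r', cE <= r' ->
         entrant_profit l cE p r' <= entrant_profit l cE p r)].

(** A deviation that keeps the firm's other price isolates one customer set, whose positive weight
    cancels. Conversely, a joint deviation is bounded by adding the two segment inequalities. *)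
Lemma pure_nash_segments (R : realType) (cA cB la lb theta : R) (q : prices R) :
  0 < theta -> theta < 1 ->
  pure_nash (Game cA cB la lb theta (@uniform01_cdf R)) q <->
  segment_nash la cA cB (pAa q) (pBa q) /\
  segment_nash lb cB cA (pBb q) (pAb q).
Proof.
move=> t0 t1; have t1' : 0 < 1 - theta by rewrite subr_gt0.
case: q => x y z w.
rewrite /pure_nash /segment_nash /feasibleA /feasibleB /profitA /profitB.
rewrite /xi_a /xi_b /incumbent_profit /entrant_profit /=.
split.
- case=> [[hx hy] [hz hw] hA hB]; split; split=> // s hs.
  + have := hA s y (conj hs hy).
    by rewrite lerD2r -!mulrA ![theta * _]mulrC !mulrA ler_pM2r.
  + have := hB z s (conj hz hs).
    by rewrite lerD2l -!mulrA ![theta * _]mulrC !mulrA ler_pM2r.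
  + have := hB s w (conj hs hw).
    by rewrite lerD2r -!mulrA ![(1 - theta) * _]mulrC !mulrA ler_pM2r.
  + have := hA x s (conj hx hs).
    by rewrite lerD2l -!mulrA ![(1 - theta) * _]mulrC !mulrA ler_pM2r.
- case=> [[hx hw hAa hBa] [hz hy hBb hAb]]; split=> // s s' [hs hs'].
  + rewrite -!mulrA ![theta * _]mulrC ![(1 - theta) * _]mulrC !mulrA.
    by apply: lerD; rewrite ler_pM2r //; [exact: hAa | exact: hAb].
  + rewrite -!mulrA ![theta * _]mulrC ![(1 - theta) * _]mulrC !mulrA.
    by apply: lerD; rewrite ler_pM2r //; [exact: hBb | exact: hBa].
Qed.

Section Segment.
Set Implicit Arguments.
Unset Strict Implicit.
Variables (R : realType) (l : R).

(** * Piecewise formulas on three closed price ranges, overlapping at their endpoints *)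

Lemma cdf_low (l0 : 0 < l) (p r : R) :
  p <= r -> uniform01_cdf ((p - r) / l) = 0.
Proof.
by move=> h; rewrite /uniform01_cdf pmulr_lle0 ?invr_gt0 // subr_le0 h.
Qed.

Lemma cdf_mid (l0 : 0 < l) (p r : R) :
  r <= p -> p <= r + l -> uniform01_cdf ((p - r) / l) = (p - r) / l.
Proof.
move=> h1 h2; rewrite /uniform01_cdf [_ <= 1]ler_pdivrMr // mul1r lerBlDl h2.
case: ifP => // h; apply: le_anti; rewrite h divr_ge0 ?subr_ge0 //; exact: ltW.
Qed.

Lemma cdf_high (l0 : 0 < l) (p r : R) :
  r + l <= p -> uniform01_cdf ((p - r) / l) = 1.
Proof.
move=> h; have h1 : 1 <= (p - r) / l by rewrite ler_pdivlMr // mul1r; lra.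
rewrite /uniform01_cdf ifF; last by apply/negP => h0; lra.
by case: ifP => // h2; apply: le_anti; rewrite h1 h2.
Qed.

Lemma incumbent_low (l0 : 0 < l) (c p r : R) :
  p <= r -> incumbent_profit l c p r = p - c.
Proof. by move=> h; rewrite /incumbent_profit cdf_low // subr0 mulr1. Qed.

Lemma incumbent_mid (l0 : 0 < l) (c p r : R) :
  r <= p -> p <= r + l ->
  incumbent_profit l c p r = (p - c) * (r + l - p) / l.
Proof.
move=> h1 h2; rewrite /incumbent_profit cdf_mid //; by field; rewrite gt_eqF.
Qed.

Lemma incumbent_high (l0 : 0 < l) (c p r : R) :
  r + l <= p -> incumbent_profit l c p r = 0.
Proof. by move=> h; rewrite /incumbent_profit cdf_high // subrr mulr0. Qed.

Lemma entrant_low (l0 : 0 < l) (c p r : R) :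
  p <= r -> entrant_profit l c p r = 0.
Proof. by move=> h; rewrite /entrant_profit cdf_low // mulr0. Qed.

Lemma entrant_mid (l0 : 0 < l) (c p r : R) :
  r <= p -> p <= r + l ->
  entrant_profit l c p r = (r - c) * (p - r) / l.
Proof. by move=> h1 h2; rewrite /entrant_profit cdf_mid // mulrA. Qed.

Lemma entrant_high (l0 : 0 < l) (c p r : R) :
  r + l <= p -> entrant_profit l c p r = r - c.
Proof. by move=> h; rewrite /entrant_profit cdf_high // mulr1. Qed.

(** A first-order condition without derivatives, one-sided because the profits are quadratic on one
    price range only. A step [e] to the right changes the product by [e * (a + b - 2 * z - e)]. *)
Lemma quadratic_right_max (a b z hi : R) : z < hi ->
  (forall y, z <= y -> y <= hi -> (y - a) * (b - y) <= (z - a) * (b - z)) ->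
  a + b <= 2 * z.
Proof.
move=> zhi h; rewrite leNgt; apply/negP => hs.
pose e := Num.min (hi - z) ((a + b - 2 * z) / 2).
have e0 : 0 < e by rewrite lt_min; apply/andP; split; lra.
have e1 : e <= hi - z by rewrite ge_min lexx.
have e2 : e <= (a + b - 2 * z) / 2 by rewrite ge_min lexx orbT.
have /h : z <= z + e by lra.
have -> : z + e <= hi by lra.
move=> /(_ isT); nra.
Qed.

Lemma quadratic_left_max (a b z lo : R) : lo < z ->
  (forall y, lo <= y -> y <= z -> (y - a) * (b - y) <= (z - a) * (b - z)) ->
  2 * z <= a + b.
Proof.
move=> loz h.
suff : - b + - a <= 2 * - z by lra.
apply: (@quadratic_right_max _ _ _ (- lo)); first by lra.
move=> y hy1 hy2; have := h (- y); rewrite lerNr lerNl => /(_ hy2 hy1).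
by congr (_ <= _); ring.
Qed.

(** Charging [cE + t] with [0 <= t <= l] changes the incumbent's profit by
    [t * (l - (cE - cI) - t) / l], which is nonpositive. The entrant may not undercut [cE], so it
    sells nothing. *)
Lemma segment_corner_nash (l0 : 0 < l) (cI cE : R) :
  l <= cE - cI ->
  segment_nash l cI cE cE cE.
Proof.
move=> hl; split; [lra | lra | move=> p' hp | move=> r' hr].
- rewrite [leRHS]incumbent_low //.
  have [hpE|/ltW hpE] := leP p' cE; first by rewrite incumbent_low //; lra.
  have [hpl|/ltW hpl] := leP p' (cE + l);
    last by rewrite incumbent_high //; lra.
  by rewrite incumbent_mid // ler_pdivrMr //; nra.
- by rewrite !entrant_low.
Qed.

Lemma segment_corner_unique (l0 : 0 < l) (cI cE p r : R) : l <= cE - cI ->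
  segment_nash l cI cE p r -> p = cE /\ r = cE.
Proof.
move=> hl [hp hr hI hE].
(* Otherwise the incumbent gains by dropping to [r], where its margin is still at least [l]. *)
have hpr : p <= r.
  rewrite leNgt; apply/negP => rp.
  have := hI r ltac:(lra); rewrite incumbent_low // leNgt => /negP; apply.
  have [hpl|/ltW hpl] := leP p (r + l); last by rewrite incumbent_high //; lra.
  by rewrite incumbent_mid ?(ltW rp) // ltr_pdivrMr //; nra.
have hrp : r <= p.
  by have := hI r ltac:(lra); rewrite !incumbent_low //; lra.
suff : p <= cE by lra.
rewrite leNgt; apply/negP => hpE.
(* Undercutting [p] by [e] wins customers above cost, whereas at [r = p] the entrant sells
   nothing. *)
pose e := Num.min l ((p - cE) / 2).
have e0 : 0 < e by rewrite lt_min; apply/andP; split; lra.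
have e1 : e <= l by rewrite ge_min lexx.
have e2 : e <= (p - cE) / 2 by rewrite ge_min lexx orbT.
have := hE (p - e) ltac:(lra).
rewrite [leRHS]entrant_low // entrant_mid //; [|lra|lra].
by rewrite leNgt => /negP; apply; rewrite divr_gt0 // mulr_gt0; lra.
Qed.

Lemma mul_le_mean_sqr (a b m : R) : a + b = 2 * m -> a * b <= m * m.
Proof.
move=> h; have -> : b = 2 * m - a by lra.
by rewrite -subr_ge0 (_ : _ - _ = (a - m) ^+ 2) ?sqr_ge0 //; ring.
Qed.

(** The prices solve [2 * p = cI + r + l] and [2 * r = cE + p], and the hypotheses make both markups
    nonnegative. Each profit is then the squared markup over [l], which bounds deviations on the
    quadratic range since their two factors have a fixed sum. *)
Lemma segment_interior_nash (l0 : 0 < l) (cI cE : R) :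
  - l <= cI - cE -> cI - cE <= 2 * l ->
  segment_nash l cI cE ((2 * cI + cE + 2 * l) / 3) ((2 * cE + cI + l) / 3).
Proof.
move=> h1 h2; set p := (X in segment_nash _ _ _ X _).
set r := (X in segment_nash _ _ _ _ X).
have pE : p = (2 * cI + cE + 2 * l) / 3 by [].
have rE : r = (2 * cE + cI + l) / 3 by [].
clearbody p r.
have hrp : r <= p by lra.
have hpr : p <= r + l by lra.
split; [lra | lra | move=> p' hp | move=> r' hr].
- have -> : incumbent_profit l cI p r = (p - cI) * (p - cI) / l.
    by rewrite incumbent_mid //; congr (_ * _ / _); lra.
  rewrite ler_pdivlMr //.
  have [hpr'|/ltW hrp'] := leP p' r.
    rewrite incumbent_low //.
    (* The worst case is the endpoint [p' = r], where the factors again sum to [2 * (p - cI)]. *)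
    have /le_trans -> // : (p' - cI) * l <= (r - cI) * l.
      by rewrite ler_pM2r // lerD2r.
    by apply: mul_le_mean_sqr; lra.
  have [hpl|/ltW hpl] := leP p' (r + l).
    by rewrite incumbent_mid // divfK ?gt_eqF // mul_le_mean_sqr //; lra.
  by rewrite incumbent_high // mul0r mulr_ge0; lra.
- have -> : entrant_profit l cE p r = (r - cE) * (r - cE) / l.
    by rewrite entrant_mid //; congr (_ * _ / _); lra.
  rewrite ler_pdivlMr //.
  have [hpr'|/ltW hrp'] := leP p r'.
    by rewrite entrant_low // mul0r mulr_ge0; lra.
  have [hpl|/ltW hpl] := leP p (r' + l).
    by rewrite entrant_mid // divfK ?gt_eqF // mul_le_mean_sqr //; lra.
  rewrite entrant_high //.
  have /le_trans -> // : (r' - cE) * l <= (p - l - cE) * l.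
    by rewrite ler_pM2r //; lra.
  by apply: mul_le_mean_sqr; lra.
Qed.

Lemma segment_interior_unique (l0 : 0 < l) (cI cE p r : R) :
  cE < cI -> cI - cE <= 2 * l -> segment_nash l cI cE p r ->
  p = (2 * cI + cE + 2 * l) / 3 /\ r = (2 * cE + cI + l) / 3.
Proof.
move=> hc h2 [hp hr hI hE].
have l1 : 0 < l^-1 by rewrite invr_gt0.
have pos : 0 < entrant_profit l cE p r.
  pose e := Num.min l ((p - cE) / 2).
  have e0 : 0 < e by rewrite lt_min; apply/andP; split; lra.
  have e1 : e <= l by rewrite ge_min lexx.
  have e2 : e <= (p - cE) / 2 by rewrite ge_min lexx orbT.
  apply: lt_le_trans (hE (p - e) ltac:(lra)).
  rewrite entrant_mid //; [|lra|lra].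
  by rewrite divr_gt0 // mulr_gt0; lra.
have hrp : r < p.
  by rewrite ltNge; apply/negP => h; move: pos; rewrite entrant_low // ltxx.
have hrE : cE < r.
  rewrite lt_neqAle hr andbT; apply/eqP => h.
  by move: pos; rewrite /entrant_profit h subrr mul0r ltxx.
(* Otherwise the entrant already serves the whole set and would raise its price to [p - l]. *)
have hrl : p <= r + l.
  rewrite leNgt; apply/negP => h.
  have := hE (p - l) ltac:(lra); rewrite !entrant_high; lra.
have fE : p + cE <= 2 * r.
  rewrite addrC; apply: (@quadratic_right_max _ _ _ p) => // y hy1 hy2.
  have := hE y ltac:(lra).
  by rewrite !entrant_mid ?ler_pM2r // ?(ltW hrp) //; lra.
(* If [p = r + l], the incumbent sells nothing, so no profitable price below [r + l] may exist. With
   [fE] this forces [cI - cE = 2 * l], where the formulas still hold. *)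
have [hge|hlt] := leP (r + l) p.
  suff : r + l <= cI by split; lra.
  rewrite leNgt; apply/negP => hcI.
  pose e := Num.min l ((r + l - cI) / 2).
  have e0 : 0 < e by rewrite lt_min; apply/andP; split; lra.
  have e1 : e <= l by rewrite ge_min lexx.
  have e2 : e <= (r + l - cI) / 2 by rewrite ge_min lexx orbT.
  have := hI (r + l - e) ltac:(lra).
  rewrite [leRHS]incumbent_high // incumbent_mid //; [|lra|lra].
  by rewrite leNgt => /negP; apply; rewrite divr_gt0 // mulr_gt0; lra.
have fI : cI + (r + l) <= 2 * p.
  apply: (@quadratic_right_max _ _ _ (r + l)) => // y hy1 hy2.
  have := hI y ltac:(lra).
  by rewrite !incumbent_mid ?ler_pM2r // ?(ltW hrp) //; lra.
(* [fI] and [p < r + l] give [cI < p], which leaves room for deviations to the left. *)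
have gI : 2 * p <= cI + (r + l).
  apply: (@quadratic_left_max _ _ _ (Num.max cI r)).
    by rewrite gt_max; apply/andP; split; lra.
  move=> y; rewrite ge_max => /andP[hy1 hy1'] hy2.
  have := hI y hy1.
  by rewrite !incumbent_mid ?ler_pM2r // ?(ltW hrp) //; lra.
have gE : 2 * r <= cE + p.
  apply: (@quadratic_left_max _ _ _ (Num.max cE (p - l))).
    by rewrite gt_max; apply/andP; split; lra.
  move=> y; rewrite ge_max => /andP[hy1 hy1'] hy2.
  have := hE y hy1.
  by rewrite !entrant_mid ?ler_pM2r // ?(ltW hrp) //; lra.
by split; lra.
Qed.

End Segment.

Theorem proposition10 (R : realType) (cA cB la lb theta : R)
    (hcB : 0 <= cB) (hcA : cB <= cA)
    (hla : 0 < la) (hlb : 0 < lb)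
    (htheta0 : 0 < theta) (htheta1 : theta < 1)
    (hI1 : lb <= cA - cB) (hI2 : cA - cB <= 2 * la) :
  let G := Game cA cB la lb theta (@uniform01_cdf R) in
  let p := {| pAa := (2 * cA + cB + 2 * la) / 3;
              pAb := cA;
              pBb := cA;
              pBa := (2 * cB + cA + la) / 3 |} in
  pure_nash G p /\ (forall q : prices R, pure_nash G q -> q = p).
Proof.
have cBA : cB < cA by lra.
move=> G p; split.
- apply/pure_nash_segments => //; split.
  + by apply: segment_interior_nash => //; lra.
  + exact: segment_corner_nash.
- case=> x y z w /pure_nash_segments[] //= ha hb.
  have [-> ->] := segment_interior_unique hla cBA hI2 ha.
  by have [-> ->] := segment_corner_unique hlb hI1 hb.
Qed.
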